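(* Let $\Theta\subseteq\mathbb{R}^k$, let $p_\theta\in\mathbb{R}[z]_{2d}$, $z=(z_1,\dots,z_n)$, depend continuously on $\theta\in\Theta$, and consider $$(\mathit{POP}_\theta)\quad\min_{z\in\mathbb{R}^n}p_\theta(z),\qquad\qquad(\mathit{SOS}_\theta)\quad\max_{\gamma\in\mathbb{R}}\ \gamma\ \text{ s.t. }\ p_\theta(z)-\gamma\in\Sigma_{n,2d}.$$ Let $\bar\theta\in\Theta$ be such that $\bar\gamma:=\mathrm{val}(\mathit{POP}_{\bar\theta})=\mathrm{val}(\mathit{SOS}_{\bar\theta})$ and $p_{\bar\theta}$ has a unique minimizer $\bar z$. Let $K_{\bar z}:=\{f\in\Sigma_{n,2d}:f(\bar z)=0\}$. If $p_{\bar\theta}-\bar\gamma$ lies in the relative interior of $K_{\bar z}$, then the relaxation $(\mathit{SOS}_\theta)$ is tight and recovers the minimizer of $p_\theta$ whenever $\theta$ is close enough to $\bar\theta$.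
   Context: $\mathbb{R}[z]_{2d}$ is the vector space of real polynomials of degree at most $2d$ in $z=(z_1,\dots,z_n)$. $\Sigma_{n,2d}\subset\mathbb{R}[z]_{2d}$ is the closed convex cone of sums of squares $f=\sum_if_i^2$ with $f_i\in\mathbb{R}[z]_d$. $K_{\bar z}$ is the (exposed) face of $\Sigma_{n,2d}$ obtained by intersecting it with the hyperplane $\{f:f(\bar z)=0\}$. $\mathrm{val}$ denotes the optimal value. $(\mathit{SOS}_\theta)$ is tight at $\theta$ if $\mathrm{val}(\mathit{SOS}_\theta)=\mathrm{val}(\mathit{POP}_\theta)$. The SDP dual to $(\mathit{SOS}_\theta)$ is the problem of minimizing $\ell(p_\theta)$ over linear functionals $\ell:\mathbb{R}[z]_{2d}\to\mathbb{R}$ with $\ell(1)=1$ and $\ell(f)\ge0$ for all $f\in\Sigma_{n,2d}$; ''the relaxation recovers the minimizer'' means that this dual has a unique optimal solution and it is the evaluation functional $f\mapsto f(z_\theta)$ at the (unique) minimizer $z_\theta$ of $p_\theta$. *)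

(* Defs.v *)
From HB Require Import structures.
From mathcomp Require Import all_boot all_order all_algebra.
From mathcomp Require Import all_classical all_reals all_analysis.
(* The notations of mpoly clash with those of all_analysis. *)
From mathcomp Require Import -(notations) mpoly.

Set Implicit Arguments.
Unset Strict Implicit.
Unset Printing Implicit Defensive.

Import Order.TTheory GRing.Theory Num.Theory.
Import numFieldTopology.Exports numFieldNormedType.Exports.

Local Open Scope classical_set_scope.
Local Open Scope ring_scope.

Section PolyLe.
Variables (n : nat) (R : realType) (D : nat).

(* [mmeasure mdeg] is the [msize] of mpoly: 1 + total degree, and 0 for 0. *)
Definition deg_le_pred : {pred mpoly n R} :=
  fun p => (mmeasure (@mdeg n) p <= D.+1)%N.
Definition deg_le : qualifier 0 (mpoly n R) := [qualify p | deg_le_pred p].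

Lemma deg_le_submod : submod_closed deg_le_pred.
Proof.
split=> [|c p q]; rewrite !unfold_in /=; first by rewrite mmeasure0.
move=> hp hq; rewrite (leq_trans (mmeasureD_le _ _ _)) // geq_max hq.
by rewrite (leq_trans (mmeasureZ_le _ _ _)).
Qed.

HB.instance Definition _ :=
  GRing.isSubmodClosed.Build R (mpoly n R) deg_le_pred deg_le_submod.

(* The vector space R[z_1, ..., z_n]_D. *)
Record polyle := PolyLe {
  polyle_val :> mpoly n R;
  polyle_valP : polyle_val \is deg_le
}.

HB.instance Definition _ := [isSub for polyle_val].
HB.instance Definition _ := [Choice of polyle by <:].
HB.instance Definition _ := [SubChoice_isSubLmodule of polyle by <:].

(* Monomials of degree < D.+1 index the coordinates; R[z]_D gets the topology
   of R^N through them, i.e. its unique Hausdorff vector space topology. *)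
Definition coefs (f : polyle) : 'rV[R]_#|{: bmultinom n D.+1}| :=
  \row_i mcoeff (bmnm (enum_val i)) f.

HB.instance Definition _ :=
  Topological.copy polyle (initial_topology coefs).

Lemma deg_leC (c : R) : mpolyC n c \is deg_le.
Proof. by rewrite qualifE /deg_le_pred mmeasureC; case: (c != 0). Qed.

Definition pconst (c : R) : polyle := PolyLe (deg_leC c).

Definition peval (z : 'rV[R]_n) (f : polyle) : R :=
  meval (fun i => z ord0 i) f.

Lemma peval_is_linear (z : 'rV[R]_n) : scalar (peval z).
Proof. by move=> c f g; rewrite /peval /= mevalD mevalZ. Qed.

HB.instance Definition _ (z : 'rV[R]_n) :=
  GRing.isLinear.Build R polyle R *%R (peval z) (peval_is_linear z).

End PolyLe.

Section RelativeInterior.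
Variables (R : realType) (V : preTopologicalLmodType R).

Definition affine_hull (A : set V) : set V :=
  [set x | exists (m : nat) (t : 'I_m -> R) (a : 'I_m -> V),
    [/\ forall i, A (a i), \sum_i t i = 1 & x = \sum_i t i *: a i]].

Definition relint (A : set V) : set V :=
  [set x | A x /\ \forall y \near x, affine_hull A y -> A y].

End RelativeInterior.

Section SOS.
Variables (n d : nat) (R : realType).
Implicit Types (f p : polyle n R (2 * d)) (z : 'rV[R]_n).

Definition sos_cone : set (polyle n R (2 * d)) :=
  [set f | exists s : seq (polyle n R d),
    (f : mpoly n R) = \sum_(g <- s) (g : mpoly n R) ^+ 2].

Definition sos_face z : set (polyle n R (2 * d)) :=
  [set f | sos_cone f /\ peval z f = 0].

Definition is_minimizer p z := forall z' : 'rV[R]_n, peval z p <= peval z' p.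

Definition unique_minimizer p z :=
  is_minimizer p z /\ forall z', is_minimizer p z' -> z' = z.

Definition val_POP p : \bar R :=
  ereal_inf [set (peval z p)%:E | z in [set: 'rV[R]_n]].

Definition val_SOS p : \bar R :=
  ereal_sup [set c%:E | c in [set c : R | sos_cone (p - pconst _ _ c)]].

Definition sos_tight p := val_SOS p = val_POP p.

Definition dual_feasible (l : {scalar polyle n R (2 * d)}) :=
  l (pconst _ _ 1) = 1 /\ forall f, sos_cone f -> 0 <= l f.

Definition dual_optimal p (l : {scalar polyle n R (2 * d)}) :=
  dual_feasible l /\ forall l', dual_feasible l' -> l p <= l' p.

Definition sos_recovers p z :=
  dual_optimal p (peval z) /\ forall l, dual_optimal p l -> l =1 peval z.

End SOS.

Arguments sos_cone {n d R}.

(* Main.v *)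
Require Import Defs.
From HB Require Import structures.
From mathcomp Require Import all_boot all_order all_algebra.
From mathcomp Require Import all_classical all_reals all_analysis.
From mathcomp Require Import -(notations) mpoly.
From mathcomp Require Import ring lra.

(** Write zb for the minimizer at thetab, P for p thetab, gammab for its
    minimum, and let [sqmon] be the sum of the squares of all monomials of
    degree between 1 and d.

    Relative interiority of P - gammab in the face of zb is the existence of a
    strict certificate: moving from P - gammab a little in the direction
    opposite to [sqmon] centred at zb does not leave the face, so
    P(z) - gammab = eps * sqmon(z - zb) + SOS(z) with eps > 0
    ([relint_sos_face]).

    Conversely a strict certificate centred at w gives every conclusion
    ([certificate_tight_recovers]).  It is an optimal solution of the
    relaxation; it makes w the only minimizer because sqmon vanishes only at
    the origin; and a dual optimal functional must kill sqmon, hence by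
    Cauchy-Schwarz every nonconstant monomial in z - w of degree at most 2d,
    so it is the evaluation at w ([sos_dual_rigidity]).

    It remains to see that strict certificates survive a perturbation of P,
    with a moving centre.  The growth eps * sqmon forces a polynomial f close
    to P to have a local minimizer w close to zb
    ([perturbed_local_minimizer]).  Expand f at w and P at zb.  The two
    expansions have close coefficients ([cvg_mcoeff_translate]), and after
    subtraction of the constant terms neither has terms of degree below two,
    since w and zb are critical points.  Their difference e thus only involves
    products of two nonconstant monomials of degree at most d, and diagonal
    dominance makes (eps / 2) * sqmon + e a sum of squares
    ([sos_perturbation]).  This leaves a certificate centred at w with
    constant eps / 2 ([perturbed_certificate]); in particular the local
    minimizer w is global. *)

Set Implicit Arguments.
Unset Strict Implicit.
Unset Printing Implicit Defensive.

Import Order.TTheory GRing.Theory Num.Theory.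
Import numFieldTopology.Exports numFieldNormedType.Exports.

Local Open Scope classical_set_scope.
Local Open Scope ring_scope.

Local Notation "p @_ m" := (mcoeff m p)
  (at level 3, m at level 1, left associativity, format "p @_ m").
Local Notation "''X_[' m ]" := (mpolyX _ m) (at level 1, format "''X_[' m ]").
Local Notation "c %:MP" := (mpolyC _ c) (at level 1, format "c %:MP").
Local Notation "m1 +m m2" := (mnm_add m1 m2) (at level 50).
Local Notation deg_le D := (Defs.deg_le _ _ D).

(** * Monomials *)

Section Monomials.
Variables (n : nat).
Implicit Types m : multinom n.

Lemma mnm_neq0 m : m != mnm0 -> exists i, m i != 0%N.
Proof.
rewrite -mdeg_eq0 mdegE sum_nat_eq0 negb_forall => /existsP[i /= mi].
by exists i.
Qed.

Lemma mnm_split m k : (k <= mdeg m)%N ->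
  exists a b, m = a +m b /\ mdeg a = k.
Proof.
elim: k => [|k IH] lekm.
  by exists mnm0, m; rewrite add0m mdeg0.
have [a [b [mE dega]]] := IH (ltnW lekm).
have : b != mnm0.
  by apply: contraTneq lekm => b0; rewrite mE mdegD b0 mdeg0 addn0 dega ltnn.
move=> /mnm_neq0[i bi].
exists (a +m mnm1 i), (mnm_sub b (mnm1 i)); split; last first.
  by rewrite mdegD mdeg1 dega addn1.
by rewrite -addmA [mnm1 i +m _]addmC submK ?lep1mP.
Qed.

(** Halving the degree keeps both factors nonconstant from degree two on. *)
Lemma mnm_halve d m : (mdeg m <= 2 * d)%N ->
  exists a b, [/\ m = a +m b, mdeg a = uphalf (mdeg m),
    mdeg b = (mdeg m)./2 & (mdeg a <= d)%N && (mdeg b <= d)%N].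
Proof.
move=> lem; have le1 : (uphalf (mdeg m) <= mdeg m)%N.
  by rewrite uphalf_half -[leqRHS]odd_double_half leq_add2l -addnn leq_addr.
have [a [b [mE dega]]] := mnm_split le1.
have degb : mdeg b = (mdeg m)./2.
  apply/eqP; rewrite -(eqn_add2l (mdeg a)) -mdegD -mE dega uphalf_half.
  by rewrite -addnA addnn odd_double_half.
exists a, b; split=> //; rewrite dega degb; move: lem; rewrite mul2n => lem.
by rewrite leq_uphalf_double lem -(doubleK d) half_leq.
Qed.

End Monomials.

(** * Degree bounds, translations and sums of squares *)

Section SumsOfSquares.
Variables (n : nat) (R : realType).
Implicit Types (f g : mpoly n R) (w z : 'rV[R]_n).

Lemma deg_leW a b f : (a <= b)%N -> f \is deg_le a -> f \is deg_le b.
Proof. by rewrite !qualifE /deg_le_pred => leab /leq_trans->. Qed.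

Lemma deg_le_mcoeff D f m : f \is deg_le D -> (D < mdeg m)%N -> f@_m = 0.
Proof. by move=> fD Dm; apply/memN_msupp_eq0/msize_mdeg_ge/(leq_trans fD). Qed.

Lemma deg_leX D m : (mdeg m <= D)%N -> ('X_[m] : mpoly n R) \is deg_le D.
Proof. by rewrite qualifE /deg_le_pred mmeasureX. Qed.

Lemma deg_leM a b f g :
  f \is deg_le a -> g \is deg_le b -> f * g \is deg_le (a + b).
Proof.
move=> fa gb; have [->|fg0] := eqVneq (f * g) 0; first by rewrite rpred0.
have [f0 g0] : f != 0 /\ g != 0.
  by split; apply: contraNneq fg0 => ->; rewrite ?mul0r ?mulr0.
move: fa gb; rewrite !qualifE /deg_le_pred -!mlead_deg // !ltnS => fa gb.
apply: leq_trans (lemc_mdeg (mleadM_le f g)) _.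
by rewrite mdegD leq_add.
Qed.

Lemma deg_le_prod (I : finType) (F : I -> mpoly n R) (a : I -> nat) :
  (forall i, F i \is deg_le (a i)) -> \prod_i F i \is deg_le (\sum_i a i).
Proof.
move=> Fa; elim/big_rec2: _ => [|i a' F' _ IH]; last exact: deg_leM.
by rewrite -mpolyC1 deg_leC.
Qed.

Lemma deg_le_exp a k f : f \is deg_le a -> f ^+ k \is deg_le (k * a).
Proof.
move=> fa; elim: k => [|k IH]; first by rewrite expr0 -mpolyC1 deg_leC.
by rewrite exprS mulSn deg_leM.
Qed.

(** Substitution of X + w for X: the coefficients of the result are those of
    the Taylor expansion at w. *)
Definition translate w : mpoly n R -> mpoly n R :=
  comp_mpoly [tuple 'X_[mnm1 i] + (w 0 i)%:MP | i < n].

HB.instance Definition _ w := GRing.RMorphism.on (translate w).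
HB.instance Definition _ w := GRing.Linear.on (translate w).

Lemma translateX w m :
  translate w 'X_[m] = \prod_i ('X_[mnm1 i] + (w 0 i)%:MP) ^+ m i.
Proof.
by rewrite /translate comp_mpolyX; apply: eq_bigr => i _; rewrite tnth_mktuple.
Qed.

Lemma translateC w c : translate w c%:MP = c%:MP.
Proof. exact: comp_mpolyC. Qed.

Lemma translateK w : cancel (translate w) (translate (- w)).
Proof.
move=> f; transitivity (\sum_(m <- msupp f) f@_m *: 'X_[m] : mpoly n R).
  2: by rewrite -mpolyE.
rewrite {1}[f]mpolyE (linear_sum (translate w)).
rewrite (linear_sum (translate (- w))).
apply: eq_bigr => m _.
rewrite !linearZ /= translateX rmorph_prod mpolyXE_id; congr (_ *: _).
apply: eq_bigr => i _; rewrite rmorphXn rmorphD /= translateC /translate.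
by rewrite comp_mpolyXU -tnth_nth tnth_mktuple mxE mpolyCN subrK.
Qed.

Lemma meval_translate w f z :
  meval (fun i => z 0 i) (translate w f) = meval (fun i => (z + w) 0 i) f.
Proof.
rewrite /translate comp_mpoly_meval; apply: meval_eq => i /=.
by rewrite tnth_mktuple mevalD mevalXU mevalC mxE.
Qed.

Lemma deg_le_translate D w f : f \is deg_le D -> translate w f \is deg_le D.
Proof.
move=> fD; rewrite [f]mpolyE (linear_sum (translate w)) big_seq.
rewrite rpred_sum // => m fm.
rewrite linearZ rpredZ //= translateX.
apply: (@deg_leW (mdeg m)).
  by rewrite -ltnS; exact: leq_trans (msize_mdeg_lt fm) fD.
rewrite mdegE; apply: deg_le_prod => i; rewrite -[X in deg_le X]muln1.
apply: deg_le_exp; rewrite rpredD //; first by rewrite deg_leX ?mdeg1.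
exact: (deg_leW _ (deg_leC _ 0 _)).
Qed.

(** Sums of squares as bare polynomials, so that they can be multiplied and
    translated without carrying degree bounds in the type. *)
Definition sos d f := exists s : seq (polyle n R d),
  f = \sum_(g <- s) (g : mpoly n R) ^+ 2.

Lemma sos0 d : sos d 0.
Proof. by exists [::]; rewrite big_nil. Qed.

Lemma sosD d f g : sos d f -> sos d g -> sos d (f + g).
Proof. by move=> [s ->] [t ->]; exists (s ++ t); rewrite big_cat. Qed.

Lemma sosZ d c f : 0 <= c -> sos d f -> sos d (c *: f).
Proof.
move=> c0 [s ->].
exists [seq Num.sqrt c *: g : polyle n R d | g : polyle n R d <- s].
rewrite big_map scaler_sumr; apply: eq_bigr => g _ /=.
by rewrite exprZn sqr_sqrtr.
Qed.

Lemma sos_sum d (I : Type) (r : seq I) (P : pred I) (F : I -> mpoly n R) :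
  (forall i, P i -> sos d (F i)) -> sos d (\sum_(i <- r | P i) F i).
Proof. by move=> FP; elim/big_ind: _ => //; [exact: sos0 | exact: sosD]. Qed.

Lemma sos_sqr d f : f \is deg_le d -> sos d (f ^+ 2).
Proof. by move=> fd; exists [:: PolyLe fd]; rewrite big_seq1. Qed.

Lemma sos_translate d w f : sos d f -> sos d (translate w f).
Proof.
move=> [s ->]; rewrite (linear_sum (translate w)); apply: sos_sum => g _.
by rewrite rmorphXn; apply/sos_sqr/deg_le_translate/polyle_valP.
Qed.

Lemma sos_ge0 d f v : sos d f -> 0 <= meval v f.
Proof.
move=> [s ->]; rewrite raddf_sum; apply: sumr_ge0 => g _ /=.
by rewrite rmorphXn sqr_ge0.
Qed.

(** This polynomial is interior in the cone of sums of squares vanishing at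
    the origin: its Gram matrix in the nonconstant monomials is the
    identity. *)
Definition sqmon d : mpoly n R :=
  \sum_(m : bmultinom n d.+1 | (0 < mdeg m)%N) 'X_[m] ^+ 2.

Lemma sos_sqmon d : sos d (sqmon d).
Proof.
by apply: sos_sum => m _; apply: sos_sqr; rewrite deg_leX // -ltnS bmdeg.
Qed.

Lemma sos_sqmonB d m : (0 < mdeg m)%N -> (mdeg m <= d)%N ->
  sos d (sqmon d - 'X_[m] ^+ 2).
Proof.
move=> m0; rewrite -ltnS => md; rewrite /sqmon (bigD1 (BMultinom md)) //=.
rewrite addrAC subrr add0r; apply: sos_sum => m' _; apply: sos_sqr.
by rewrite deg_leX // -ltnS bmdeg.
Qed.

(** Writing 'X_[m] as a product x * y of two nonconstant monomials of degree
    at most d, this is diagonal dominance: (eta / 2) * (x^2 + y^2) + c * x * y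
    is a sum of squares.  The squares x^2 and y^2 are taken from two separate
    halves of eta * sqmon, because x and y may coincide. *)
Lemma sos_monomial_perturbation d eta c m :
  (2 <= mdeg m)%N -> (mdeg m <= 2 * d)%N -> `|c| <= eta ->
  sos d (eta *: sqmon d + c *: 'X_[m]).
Proof.
move=> m2 md; rewrite ler_norml => /andP[c1 c2].
have [a [b [mE dega degb /andP[ad bd]]]] := mnm_halve md.
have b0 : (0 < mdeg b)%N by rewrite degb half_gt0.
have a0 : (0 < mdeg a)%N.
  by rewrite dega uphalf_half (leq_trans _ (leq_addl _ _)) // half_gt0.
pose s := (eta + c) / 4; pose t := (eta - c) / 4.
have s0 : 0 <= s by rewrite /s; lra.
have t0 : 0 <= t by rewrite /t; lra.
have -> : eta *: sqmon d + c *: 'X_[m] =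
    (s + t) *: (sqmon d - 'X_[a] ^+ 2) + (s + t) *: (sqmon d - 'X_[b] ^+ 2) +
    (s *: ('X_[a] + 'X_[b]) ^+ 2 + t *: ('X_[a] - 'X_[b]) ^+ 2).
  have -> : eta = (s + t) + (s + t) by rewrite /s /t; field.
  have -> : c = (s - t) + (s - t) by rewrite /s /t; field.
  rewrite mE mpolyXD -!mul_mpolyC !mpolyCD mpolyCN.
  by ring.
apply: sosD; apply: sosD; apply: sosZ; rewrite ?addr_ge0 //.
- exact: sos_sqmonB.
- exact: sos_sqmonB.
- by apply: sos_sqr; rewrite rpredD // deg_leX.
- by apply: sos_sqr; rewrite rpredB // deg_leX.
Qed.

(** Each monomial of e consumes its own share eta of [sqmon]. *)
Lemma sos_perturbation d eta e : e \is deg_le (2 * d) ->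
  (forall m, (mdeg m < 2)%N -> e@_m = 0) -> (forall m, `|e@_m| <= eta) ->
  sos d ((eta *+ #|{: bmultinom n (2 * d).+1}|) *: sqmon d + e).
Proof.
move=> eD e1 ee; rewrite (mpolywE eD) -mulr_natr -sum1_card natr_sum mulr_sumr.
rewrite scaler_suml -big_split /=; apply: sos_sum => m _; rewrite mulr1.
have eta0 : 0 <= eta by exact: le_trans (ee mnm0).
have [m2|m2] := leqP 2 (mdeg m); last first.
  by rewrite e1 // scale0r addr0; apply: sosZ => //; exact: sos_sqmon.
by apply: sos_monomial_perturbation => //; rewrite -ltnS bmdeg.
Qed.

End SumsOfSquares.

(** * The dual cone *)

Section PolynomialSpace.
Variables (n : nat) (R : realType) (D : nat).

Lemma trunc_subproof (f : mpoly n R) :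
  \sum_(m : bmultinom n D.+1) f@_m *: 'X_[m] \is deg_le D.
Proof.
by apply: rpred_sum => m _; rewrite rpredZ // deg_leX // -ltnS bmdeg.
Qed.

(** Truncation extends a functional on polynomials of bounded degree to all
    polynomials, where products are available. *)
Definition trunc (f : mpoly n R) : polyle n R D := PolyLe (trunc_subproof f).

Lemma trunc_is_linear : linear trunc.
Proof.
move=> c f g; apply: val_inj; rewrite /= scaler_sumr -big_split /=.
by apply: eq_bigr => m _; rewrite mcoeffD mcoeffZ scalerDl scalerA.
Qed.

HB.instance Definition _ :=
  GRing.isLinear.Build R (mpoly n R) (polyle n R D) *:%R trunc trunc_is_linear.

Lemma val_trunc f : f \is deg_le D -> trunc f = f :> mpoly n R.
Proof. by move=> fD; rewrite [RHS](mpolywE fD). Qed.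

Lemma truncK (f : polyle n R D) : trunc f = f.
Proof. by apply: val_inj; exact: val_trunc (polyle_valP f). Qed.

End PolynomialSpace.

Section Duality.
Variables (n : nat) (R : realType).
Implicit Types (f g u v : mpoly n R) (L : {scalar mpoly n R}).

(** Cauchy-Schwarz in its degenerate form: a quadratic form that is
    nonnegative and vanishes at u has u in its kernel. *)
Lemma sos_dual_isotropic d L u v :
  (forall g, g \is deg_le d -> 0 <= L (g ^+ 2)) ->
  u \is deg_le d -> v \is deg_le d -> L (u ^+ 2) = 0 -> L (u * v) = 0.
Proof.
move=> Lsq ud vd Lu; have Lt (t : R) : 0 <= t * (L (u * v) *+ 2) + L (v ^+ 2).
  have : 0 <= L ((t *: u + v) ^+ 2) by rewrite Lsq // rpredD // rpredZ.
  rewrite sqrrD exprZn -scalerAl !linearD !linearZ /= Lu mulr0.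
  by rewrite add0r -mulrDr -mulr2n.
apply/eqP/negPn/negP => x0.
have := Lt (- (L (v ^+ 2) + 1) / (L (u * v) *+ 2)).
by rewrite divfK ?mulrn_eq0 //; lra.
Qed.

(** Every nonconstant monomial of degree at most 2d has a factor 'X_[a] with
    0 < mdeg a <= d, and L kills the square of 'X_[a]. *)
Lemma sos_dual_rigidity d L :
  (forall g, g \is deg_le d -> 0 <= L (g ^+ 2)) -> L (sqmon n R d) = 0 ->
  forall f, f \is deg_le (2 * d) -> L f = f@_mnm0 * L 1.
Proof.
move=> Lsq L0 f fD.
have Lsqm m : (0 < mdeg m)%N -> (mdeg m <= d)%N -> L ('X_[m] ^+ 2) = 0.
  move=> m0; rewrite -ltnS => md; move: L0; rewrite raddf_sum /=.
  move=> /psumr_eq0P/(_ (BMultinom md) m0) -> //= m' _.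
  by rewrite Lsq // deg_leX // -ltnS bmdeg.
have Lm m : (0 < mdeg m)%N -> (mdeg m <= 2 * d)%N -> L 'X_[m] = 0.
  move=> m0 md; have [a [b [mE dega degb /andP[ad bd]]]] := mnm_halve md.
  rewrite mE mpolyXD; apply: (sos_dual_isotropic Lsq); rewrite ?deg_leX //.
  by apply: Lsqm => //; rewrite dega uphalf_gt0.
rewrite [in LHS](mpolywE fD) raddf_sum (bigD1 bm0) //= big1 ?addr0 => [|m].
  by rewrite linearZ /= mpolyX0.
rewrite -val_eqE /= -mdeg_eq0 -lt0n => m0.
by rewrite linearZ /= Lm ?mulr0 // -ltnS bmdeg.
Qed.

End Duality.

(** * Strict certificates *)

Section Certificate.
Variables (n d : nat) (R : realType).

Lemma deg_le_sos (f : mpoly n R) : sos d f -> f \is deg_le (2 * d).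
Proof.
move=> [s ->]; apply: rpred_sum => g _.
by apply: deg_le_exp; exact: polyle_valP.
Qed.

Implicit Types (p : polyle n R (2 * d)) (w z : 'rV[R]_n).

Lemma sqmon_ge_sqr (i : 'I_n) (v : 'I_n -> R) : ((0 < n)%N -> (0 < d)%N) ->
  v i ^+ 2 <= meval v (sqmon n R d).
Proof.
move=> /(_ (leq_ltn_trans (leq0n i) (ltn_ord i))) d0; rewrite -subr_ge0.
have /(sos_ge0 v) : sos d (sqmon n R d - 'X_[mnm1 i] ^+ 2).
  by apply: sos_sqmonB; rewrite mdeg1.
by rewrite mevalB rmorphXn /= mevalXU.
Qed.

Lemma mcoeff0_meval (f : mpoly n R) :
  f@_mnm0 = meval (fun i => (0 : 'rV[R]_n) 0 i) f.
Proof.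
rewrite mevalE {1}[f]mpolyE raddf_sum; apply: eq_bigr => m _ /=.
rewrite mcoeffZ mcoeffX; congr (_ * _).
have [->|/mnm_neq0[i mi]] := eqVneq m mnm0.
  by rewrite big1 // => i _; rewrite mnm0E expr0.
by rewrite (bigD1 i) //= mxE expr0n (negbTE mi) mul0r.
Qed.

(** A sum of squares certificate with a positive multiple of [sqmon], i.e.
    with a positive definite Gram matrix, settles every conclusion at once:
    [sqmon] vanishes only at the origin, and a dual optimal functional must
    kill it. *)
Lemma certificate_tight_recovers p w (eps : R) S :
  ((0 < n)%N -> (0 < d)%N) -> 0 < eps -> sos d S ->
  translate w p - (peval w p)%:MP = eps *: sqmon n R d + S ->
  sos_tight p /\ exists z, unique_minimizer p z /\ sos_recovers p z.
Proof.
move=> d_gt0 eps0 Ssos pE; set c := peval w p in pE.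
have rsos : sos d (translate w p - c%:MP).
  by rewrite pE; apply: sosD => //; apply: sosZ (ltW eps0) (sos_sqmon _ _ _).
have pc_sos : sos_cone (p - pconst n (2 * d) c).
  have -> : sos_cone (p - pconst n (2 * d) c) =
      sos d (translate (- w) (translate w p - c%:MP)).
    by rewrite raddfB /= translateK translateC.
  exact: sos_translate.
have peE z : peval z p = meval (fun i => (z - w) 0 i) (translate w p).
  by rewrite meval_translate subrK.
have w_min : is_minimizer p w.
  move=> z; rewrite -subr_ge0 peE -/c.
  by have := sos_ge0 (fun i => (z - w) 0 i) rsos; rewrite mevalB mevalC.
have POPE : val_POP p = c%:E.
  apply/eqP; rewrite eq_le; apply/andP; split.
    by apply: ereal_inf_lbound; exists w.
  by apply: le_ereal_inf_tmp => _ [z _ <-]; rewrite lee_fin; exact: w_min.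
split.
  rewrite /sos_tight POPE; apply/eqP; rewrite eq_le; apply/andP; split.
    apply: ge_ereal_sup => _ [b /= bsos <-]; rewrite lee_fin.
    have := @sos_ge0 _ _ d _ (fun i => w 0 i) bsos.
    by rewrite /= mevalB mevalC subr_ge0.
  by apply: ereal_sup_ubound; exists c.
exists w; split.
  split=> // z zmin; apply/rowP => i; apply/eqP; rewrite -subr_eq0 -sqrf_eq0.
  rewrite eq_le sqr_ge0 andbT.
  have le0 : eps * meval (fun i => (z - w) 0 i) (sqmon n R d) <= 0.
    have /(congr1 (meval (fun i => (z - w) 0 i))) := pE.
    rewrite mevalB mevalC -peE mevalD mevalZ.
    have := zmin w; have := sos_ge0 (fun i => (z - w) 0 i) Ssos.
    by rewrite -/c; lra.
  have := sqmon_ge_sqr i (fun i => (z - w) 0 i) d_gt0.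
  by rewrite !mxE => /le_trans; apply; rewrite -(pmulr_rle0 _ eps0).
have w_feas : dual_feasible (peval w : {scalar polyle n R (2 * d)}).
  by split; [exact: mevalC | move=> f; exact: sos_ge0].
have c_opt l : dual_feasible l -> c <= l p.
  move=> [l1 l0]; rewrite -subr_ge0.
  have := l0 _ pc_sos; rewrite raddfB /=.
  suff -> : pconst n (2 * d) c = c *: pconst n (2 * d) 1.
    by rewrite linearZ /= l1 mulr1.
  by apply: val_inj; rewrite /= -mul_mpolyC -mpolyCM mulr1.
split; first by split.
move=> l [[l1 l0] lopt] f.
(* L is l read in coordinates centred at w. *)
have [L Lsos LE] : exists2 L : {scalar mpoly n R},
    forall g, sos d g -> 0 <= L g &
    forall g : polyle n R (2 * d), L (translate w g) = l g.
  exists (l \o (trunc (2 * d) \o translate (- w))) => g /=; last first.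
    by rewrite translateK truncK.
  move=> /(sos_translate (- w)) gsos; apply: l0.
  by move: (gsos); rewrite -{1}(val_trunc (deg_le_sos gsos)).
have L1 : L 1 = 1.
  rewrite -l1 -(LE (pconst n _ 1)) /= translateC.
  by rewrite mpolyC1.
have Lsq g : g \is deg_le d -> 0 <= L (g ^+ 2).
  by move=> gd; apply/Lsos/sos_sqr.
have Lsqmon : L (sqmon n R d) = 0.
  apply/eqP; rewrite eq_le Lsos ?andbT; last exact: sos_sqmon.
  have := congr1 L pE; rewrite raddfB /=.
  have := lopt _ w_feas; have := Lsos _ Ssos.
  rewrite linearD linearZ /= LE -/c -(pmulr_rle0 (L _) eps0).
  rewrite -[c%:MP]mulr1 mul_mpolyC linearZ /= L1 mulr1.
  by lra.
rewrite -LE (sos_dual_rigidity Lsq Lsqmon); last first.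
  exact/deg_le_translate/polyle_valP.
by rewrite L1 mulr1 mcoeff0_meval meval_translate add0r.
Qed.

End Certificate.

(** * Continuity of coefficients and translations *)

Section Continuity.
Variables (n : nat) (R : realType).

Lemma nbhs_rV_ltP (w : 'rV[R]_n) (A : set 'rV[R]_n) :
  nbhs w A <-> exists2 rho, 0 < rho &
    forall z : 'rV[R]_n, (forall i, `|z 0 i - w 0 i| < rho) -> A z.
Proof.
split=> [/nbhs_ballP[e /= e0 eA]|[e e0 eA]].
  exists e => // z zw; apply: eA; split=> // i j.
  by rewrite ord1 -ball_normE /ball_ /= distrC.
apply/nbhs_ballP; exists e => //= z [_ zw]; apply: eA => i.
by rewrite distrC; have := zw 0 i; rewrite -ball_normE.
Qed.

Section Filtered.
Variables (T : Type) (F : set_system T).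
Context {FF : Filter F}.
Implicit Types (u v : T -> mpoly n R) (f g : mpoly n R).

Let cvgc u f := forall m, (u t)@_m @[t --> F] --> (f@_m : R).

Let cvgcM u v f g : cvgc u f -> cvgc v g ->
  cvgc (fun t => u t * v t) (f * g).
Proof.
move=> uf vg m; rewrite mcoeffM; under eq_cvg do rewrite mcoeffM.
apply: cvg_big => [|k _]; first exact: add_continuous.
exact: cvgM.
Qed.

Let cvgcX u f k : cvgc u f -> cvgc (fun t => u t ^+ k) (f ^+ k).
Proof.
move=> uf; elim: k => [|k IH] m.
  by rewrite expr0; under eq_cvg do rewrite expr0; exact: cvg_cst.
by rewrite exprS; under eq_cvg do rewrite exprS; exact: cvgcM.
Qed.

Let cvgc_prod (I : Type) (r : seq I) (U : I -> T -> mpoly n R)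
    (G : I -> mpoly n R) : (forall i, cvgc (U i) (G i)) ->
  cvgc (fun t => \prod_(i <- r) U i t) (\prod_(i <- r) G i).
Proof.
move=> UG; elim: r => [|i r IH] m.
  by rewrite big_nil; under eq_cvg do rewrite big_nil; exact: cvg_cst.
by rewrite big_cons; under eq_cvg do rewrite big_cons; exact: cvgcM.
Qed.

(** The coefficients of a translate are polynomial in the coefficients and in
    the translation vector. *)
Lemma cvg_mcoeff_translate D (u : T -> mpoly n R) f (w : T -> 'rV[R]_n)
    (w0 : 'rV[R]_n) :
  (forall t, u t \is deg_le D) -> f \is deg_le D ->
  (forall m, (u t)@_m @[t --> F] --> (f@_m : R)) ->
  (forall i, w t 0 i @[t --> F] --> (w0 0 i : R)) ->
  forall m, (translate (w t) (u t))@_m @[t --> F] --> ((translate w0 f)@_m : R).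
Proof.
move=> uD fD uf ww0.
have tE (v : 'rV[R]_n) g m : g \is deg_le D -> (translate v g)@_m =
    \sum_(k : bmultinom n D.+1) g@_k *
      (\prod_i ('X_[mnm1 i] + (v 0 i)%:MP) ^+ (k : multinom n) i)@_m.
  move=> gD; rewrite {1}(mpolywE gD) (linear_sum (translate v)) raddf_sum.
  by apply: eq_bigr => k _; rewrite /= linearZ mcoeffZ /= translateX.
move=> m; rewrite tE //; under eq_cvg do rewrite tE //.
apply: cvg_big => [|k _]; first exact: add_continuous.
apply: cvgM => //.
apply: (@cvgc_prod _ _ (fun i t => ('X_[mnm1 i] + (w t 0 i)%:MP) ^+
  (k : multinom n) i)) => i; apply: cvgcX => j.
rewrite mcoeffD mcoeffC; under eq_cvg do rewrite mcoeffD mcoeffC.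
by apply: cvgD; [exact: cvg_cst | apply: cvgM; [exact: ww0 | exact: cvg_cst]].
Qed.

End Filtered.

Lemma continuous_meval (f : mpoly n R) :
  continuous (fun z : 'rV[R]_n => meval (fun i => z 0 i) f).
Proof.
move=> z.
have tE (v : 'rV[R]_n) : meval (fun i => v 0 i) f = (translate v f)@_mnm0.
  by rewrite mcoeff0_meval meval_translate add0r.
rewrite /continuous_at tE; under eq_cvg do rewrite tE.
apply: (@cvg_mcoeff_translate _ (nbhs z) (nbhs_filter z) (mmeasure (@mdeg n) f)
  (fun=> f) f id) => //.
- by move=> _; rewrite qualifE /deg_le_pred.
- by rewrite qualifE /deg_le_pred.
- by move=> m; exact: cvg_cst.
- by move=> i; exact: coord_continuous.
Qed.

End Continuity.

Section PolynomialSpaceConvergence.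
Variables (n D : nat) (R : realType) (T : Type) (F : set_system T).
Context {FF : Filter F}.
Implicit Types (u : T -> polyle n R D) (f : polyle n R D).

Lemma cvg_mcoeff u f m : u @ F --> f ->
  (u t : mpoly n R)@_m @[t --> F] --> ((f : mpoly n R)@_m : R).
Proof.
move=> uf; have [mD|Dm] := leqP (mdeg m) D; last first.
  rewrite (deg_le_mcoeff (polyle_valP f)) //.
  by under eq_cvg do rewrite (deg_le_mcoeff (polyle_valP _)) //; exact: cvg_cst.
pose k : bmultinom n D.+1 := BMultinom (mD : (mdeg m < D.+1)%N).
have kE (g : polyle n R D) : (g : mpoly n R)@_m = coefs g 0 (enum_rank k).
  by rewrite mxE enum_rankK.
rewrite kE; under eq_cvg do rewrite kE.
have uc : coefs (u t) @[t --> F] --> coefs f.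
  by apply: (cvg_comp _ _ uf) => A /initial_continuous.
exact: (cvg_comp _ _ uc (@coord_continuous _ _ _ _ _ _)).
Qed.

(** Reduces a bound on all coefficients to finitely many, since limits commute
    only with finite conjunctions. *)
Lemma mcoeff_dist_le (g h : mpoly n R) (c : R) :
  0 < c -> g \is deg_le D -> h \is deg_le D ->
  (forall m : bmultinom n D.+1, `|g@_m - h@_m| <= c) ->
  forall m, `|g@_m - h@_m| <= c.
Proof.
move=> c0 gD hD gh m; have [mD|Dm] := leqP (mdeg m) D.
  exact: (gh (BMultinom (mD : (mdeg m < D.+1)%N))).
by rewrite !(@deg_le_mcoeff _ _ D) // subrr normr0 ltW.
Qed.

Lemma near_mcoeff_le u f eta : u @ F --> f -> 0 < eta ->
  \forall t \near F, forall m,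
    `|(u t : mpoly n R)@_m - (f : mpoly n R)@_m| <= eta.
Proof.
move=> uf eta0.
have near1 (m : bmultinom n D.+1) :
    \forall t \near F, `|(u t : mpoly n R)@_m - (f : mpoly n R)@_m| <= eta.
  move: (cvg_mcoeff (m := m) uf) => /cvgr_dist_le/(_ eta eta0).
  by apply: filterS => t; rewrite distrC.
apply: filterS (filter_forall _ near1) => t ut.
exact: mcoeff_dist_le eta0 (polyle_valP _) (polyle_valP _) ut.
Qed.

Lemma near_translate_le u f (z : 'rV[R]_n) eta : u @ F --> f -> 0 < eta ->
  exists2 rho, 0 < rho & \forall t \near F, forall w : 'rV[R]_n,
    (forall i, `|w 0 i - z 0 i| < rho) ->
    forall m, `|(translate w (u t))@_m - (translate z f)@_m| <= eta.
Proof.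
move=> uf eta0; have zF : Filter (nbhs z) := nbhs_filter z.
have near1 (m : bmultinom n D.+1) : \forall x \near filter_prod F (nbhs z),
    `|(translate x.2 (u x.1))@_m - (translate z f)@_m| <= eta.
  have : (translate x.2 (u x.1))@_m @[x --> filter_prod F (nbhs z)] -->
      ((translate z f)@_m : R).
    apply: (@cvg_mcoeff_translate n R _ (filter_prod F (nbhs z)) _ D
      (fun x => u x.1 : mpoly n R) f snd) => [[t w]||m'|i].
    - exact: polyle_valP.
    - exact: polyle_valP.
    - exact: (cvg_comp _ _ cvg_fst (cvg_mcoeff (m := m') uf)).
    - move=> V /(@coord_continuous R 1 n 0 i z) nV.
      exists (setT, fun w : 'rV[R]_n => V (w 0 i)).
        by split=> //=; exact: filterT.
      by move=> [? ?] [].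
  move/cvgr_dist_le => /(_ eta eta0); apply: filterS => x.
  by rewrite distrC.
have [[A B] [/= FA nB] AB] := filter_forall _ near1.
have [rho rho0 rhoB] := (nbhs_rV_ltP z B).1 nB.
exists rho => //; apply: filterS FA => t At w /rhoB Bw.
have fD := polyle_valP f.
apply: mcoeff_dist_le eta0 _ _ (AB (t, w) (conj At Bw)) => /=.
  exact/deg_le_translate/polyle_valP.
exact: deg_le_translate.
Qed.

End PolynomialSpaceConvergence.

(** * Perturbed minimizers *)

Section Minimizers.
Variables (n : nat) (R : realType).
Implicit Types (f : mpoly n R) (w z : 'rV[R]_n).

Lemma linear_coef_eq0 (c C : R) : 0 <= C ->
  (\forall t \near (0 : R), 0 <= c * t + C * t ^+ 2) -> c = 0.
Proof.
move=> C0 /nbhs_norm0P[e /= e0 ec]; apply/eqP/negPn/negP => c0.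
(* The test point t = - c / K, where K > C makes the linear term win and
   K > |c| / e keeps t in the neighbourhood. *)
pose K := C + 1 + 2 * `|c| / e.
have ce0 : 0 < 2 * `|c| / e by rewrite divr_gt0 // mulr_gt0 // normr_gt0.
have K0 : 0 < K by rewrite /K; lra.
have /ec : `|- c / K| < e.
  rewrite normrM normrN normfV (gtr0_norm K0) ltr_pdivrMr // /K.
  have -> : e * (C + 1 + 2 * `|c| / e) = e * C + e + 2 * `|c|.
    by field; exact: lt0r_neq0.
  have := normr_ge0 c; have := mulr_ge0 (ltW e0) C0; lra.
have -> : c * (- c / K) + C * (- c / K) ^+ 2 = (c / K) ^+ 2 * (C - K).
  by field; exact: lt0r_neq0.
have cK0 : 0 < (c / K) ^+ 2.
  by rewrite exprn_even_gt0 //= mulf_neq0 // invr_neq0 // lt0r_neq0.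
by rewrite pmulr_rge0 // /K; lra.
Qed.

(** First order optimality: along a coordinate axis the remaining terms are
    at least quadratic. *)
Lemma mcoeff_translate_min f w (i : 'I_n) :
  (\forall z \near w, meval (fun j => w 0 j) f <=
                       meval (fun j => (z : 'rV[R]_n) 0 j) f) ->
  (translate w f)@_(mnm1 i) = 0.
Proof.
move=> /nbhs_rV_ltP[rho rho0 wmin]; set g := translate w f.
(* r gathers the terms of g other than the constant one and the one in
   X_i; on the i-th axis they are quadratic. *)
pose r := g - (g@_mnm0)%:MP - g@_(mnm1 i) *: 'X_[mnm1 i].
pose y (t : R) : 'rV[R]_n := \row_j (t * (i == j)%:R).
pose C := \sum_(m <- msupp r) `|r@_m|.
have yi t : y t 0 i = t by rewrite mxE eqxx mulr1.
have rC t : `|t| <= 1 -> `|meval (fun j => y t 0 j) r| <= C * t ^+ 2.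
  move=> t1; rewrite mevalE mulr_suml; apply: (le_trans (ler_norm_sum _ _ _)).
  rewrite big_seq [leRHS]big_seq; apply: ler_sum => m mr.
  rewrite normrM ler_wpM2l // normr_prod (bigD1 i) //= yi.
  have [[j ji mj]|m0] := pselect (exists2 j, j != i & m j != 0%N).
    rewrite (bigD1 j) //= mxE eq_sym (negbTE ji) mulr0 expr0n (negbTE mj).
    by rewrite normr0 mul0r mulr0 sqr_ge0.
  have m0' j : j != i -> m j = 0%N.
    by move=> ji; apply/eqP/negPn/negP => mj; apply: m0; exists j.
  rewrite big1 => [|j ji]; last by rewrite m0' // expr0 normr1.
  rewrite mulr1 normrX -(real_normK (num_real t)).
  have [m2|] := leqP 2 (m i); first exact: ler_wiXn2l.
  move=> m2; exfalso; move: mr; rewrite mcoeff_msupp => /negP; apply.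
  rewrite !mcoeffB mcoeffC mcoeffZ mcoeffX.
  case mi: (m i) m2 => [|[|k]] // _.
    have -> : m = mnm0.
      by apply/mnmP => j; rewrite mnm0E; have [->|/m0'] := eqVneq j i.
    by rewrite eqxx mnm1_eq0 mulr1 mulr0 subr0 subrr.
  have -> : m = mnm1 i.
    apply/mnmP => j; rewrite mnm1E; have [<-|ji] := eqVneq i j => //.
    by rewrite m0' // eq_sym.
  by rewrite mnm1_eq0 eqxx mulr1 mulr0 subr0 subrr.
apply: (@linear_coef_eq0 _ C); first exact: sumr_ge0.
apply/nbhs_norm0P; exists (Num.min 1 rho) => /=; first by rewrite lt_min ltr01.
move=> t /=; rewrite lt_min => /andP[t1 trho].
have /wmin : forall j, `|(y t + w) 0 j - w 0 j| < rho.
  move=> j; rewrite !mxE addrK; case: eqP => _; first by rewrite mulr1.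
  by rewrite mulr0 normr0.
rewrite -meval_translate -/g -{1}[w]add0r -meval_translate -mcoeff0_meval -/g.
have := rC _ (ltW t1); rewrite ler_norml => /andP[_].
rewrite /r !mevalB mevalC mevalZ mevalXU yi.
by lra.
Qed.

End Minimizers.

Section Perturbation.
Variables (n d : nat) (R : realType).
Implicit Types (f g : mpoly n R) (w z : 'rV[R]_n).

Lemma meval_bound D (B eta : R) f (v : 'I_n -> R) : 1 <= B ->
  f \is deg_le D -> (forall m, `|f@_m| <= eta) -> (forall i, `|v i| <= B) ->
  `|meval v f| <= eta * (B ^+ D *+ #|{: bmultinom n D.+1}|).
Proof.
move=> B1 fD feta vB; rewrite {1}(mpolywE fD) raddf_sum /=.
apply: le_trans (ler_norm_sum _ _ _) _.
rewrite -sumr_const mulr_sumr; apply: ler_sum => m _.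
rewrite mevalZ mevalX normrM; apply: ler_pM => //.
rewrite normr_prod; apply: (@le_trans _ _ (B ^+ mdeg m)); last first.
  by rewrite ler_weXn2l // -ltnS bmdeg.
rewrite mdegE -prodrXr; apply: ler_prod => i _.
by rewrite normr_ge0 normrX lerXn2r // nnegrE ?normr_ge0 // (le_trans ler01).
Qed.

Lemma meval_sqmon0 : meval (fun i => (0 : 'rV[R]_n) 0 i) (sqmon n R d) = 0.
Proof.
rewrite -mcoeff0_meval raddf_sum big1 // => m m0 /=.
by rewrite mcoeffXn -mdeg_eq0 mdegMn muln_eq0 -leqn0 leqNgt m0.
Qed.

(** The certificate makes P grow quadratically away from zb, so a small
    perturbation cannot attain its minimum over a small box on the boundary. *)
Lemma perturbed_local_minimizer (P S : mpoly n R) (eps rho : R) zb :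
  ((0 < n)%N -> (0 < d)%N) -> P \is deg_le (2 * d) -> 0 < eps -> 0 < rho ->
  sos d S ->
  translate zb P - (meval (fun i => zb 0 i) P)%:MP = eps *: sqmon n R d + S ->
  exists2 eta, 0 < eta & forall f, f \is deg_le (2 * d) ->
    (forall m, `|f@_m - P@_m| <= eta) ->
    exists2 w : 'rV[R]_n, forall i, `|w 0 i - zb 0 i| < rho &
      \forall z \near w, meval (fun i => w 0 i) f <=
                         meval (fun i => (z : 'rV[R]_n) 0 i) f.
Proof.
move=> d_gt0 PD eps0 rho0 Ssos PE.
pose B := 1 + rho + \sum_i `|zb 0 i|.
have sum0 : 0 <= \sum_i `|zb 0 i| by exact: sumr_ge0.
have B1 : 1 <= B by rewrite /B; lra.
pose M := B ^+ (2 * d) *+ #|{: bmultinom n (2 * d).+1}|.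
have M0 : 0 <= M by rewrite mulrn_wge0 // exprn_ge0 // (le_trans ler01).
have eta0 : 0 < eps * rho ^+ 2 / (2 * (M + 1)).
  by rewrite divr_gt0 // ?mulr_gt0 // ?exprn_gt0 // ltr_pwDr.
exists (eps * rho ^+ 2 / (2 * (M + 1))) => // f fD fP.
set eta := eps * _ / _ in eta0 fP.
have etaM : eta * M * 2 < eps * rho ^+ 2.
  have -> : eps * rho ^+ 2 = eta * (2 * (M + 1)).
    by rewrite /eta divfK // lt0r_neq0 // mulr_gt0 // ltr_pwDr.
  by nra.
(* Minimize over the closed box A of radius rho around zb. *)
pose A := [set z : 'rV[R]_n | forall i,
  `[zb 0 i - rho, zb 0 i + rho]%classic (z 0 i)].
have Azb : A zb by move=> i /=; rewrite in_itv /=; apply/andP; split; lra.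
have cA : compact A.
  apply: (@rV_compact _ _ (fun i => `[zb 0 i - rho, zb 0 i + rho]%classic)).
  by move=> i; exact: segment_compact.
have [|w /set_mem wA wmin] := EVT_min_rV (ex_intro _ zb Azb) cA
    (f := fun z => meval (fun i => z 0 i) f).
  by apply: continuous_subspaceT; exact: continuous_meval.
have bnd z : A z -> `|meval (fun i => z 0 i) (f - P)| <= eta * M.
  move=> Az; apply: meval_bound => //; first by rewrite rpredB.
    by move=> m; rewrite mcoeffB.
  move=> i; have := Az i; rewrite /= in_itv /= => /andP[z1 z2].
  have zi : `|zb 0 i| <= \sum_i `|zb 0 i|.
    by rewrite (bigD1 i) //= lerDl sumr_ge0.
  rewrite ler_norml /B; move: zi; rewrite ler_norml => /andP[zi1 zi2].
  by apply/andP; split; lra.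
(* eps * (w_i - zb_i)^2 <= P(w) - P(zb) <= 2 * eta * M < eps * rho^2. *)
have wrho i : `|w 0 i - zb 0 i| < rho.
  have := bnd _ wA; have := bnd _ Azb.
  rewrite !mevalB !ler_norml => /andP[a1 a2] /andP[b1 b2].
  have := wmin zb (mem_set Azb) => fw.
  have := congr1 (meval (fun i => (w - zb) 0 i)) PE.
  rewrite mevalB mevalC meval_translate subrK mevalD mevalZ => PwE.
  have Sw := sos_ge0 (fun i => (w - zb) 0 i) Ssos.
  have sq := sqmon_ge_sqr i (fun i => (w - zb) 0 i) d_gt0.
  rewrite -(ltr_pXn2r (n := 2)) ?nnegrE ?normr_ge0 ?ltW //.
  rewrite real_normK ?num_real //.
  rewrite -(ltr_pM2l eps0).
  move: sq; rewrite !mxE -(ler_pM2l eps0) => sq.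
  by lra.
exists w => //; apply/nbhs_rV_ltP.
exists (\big[Num.min/rho]_i (rho - `|w 0 i - zb 0 i|)).
  by apply: lt_bigmin => // i _; rewrite subr_gt0.
move=> z zw; apply: wmin; rewrite inE => i /=; rewrite in_itv /=.
have : `|z 0 i - w 0 i| < rho - `|w 0 i - zb 0 i|.
  apply: lt_le_trans (zw i) _; exact: bigmin_le_cond.
rewrite ltrBrDr => h; have := le_lt_trans (ler_normD _ _) h.
rewrite addrA subrK ltr_norml => /andP[h1 h2].
by apply/andP; split; lra.
Qed.

(** What remains of the perturbation at a critical point has no terms of
    degree below two, so a multiple of [sqmon] proportional to eta absorbs
    it. *)
Lemma perturbed_certificate (P Q S : mpoly n R) (eps eta : R) w zb :
  P \is deg_le (2 * d) -> Q \is deg_le (2 * d) -> sos d S ->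
  translate zb P - (meval (fun i => zb 0 i) P)%:MP = eps *: sqmon n R d + S ->
  (forall i, (translate zb P)@_(mnm1 i) = 0) ->
  (forall i, (translate w Q)@_(mnm1 i) = 0) ->
  (forall m, `|(translate w Q)@_m - (translate zb P)@_m| <= eta) ->
  exists2 S', sos d S' & translate w Q - (meval (fun i => w 0 i) Q)%:MP =
    (eps - eta *+ #|{: bmultinom n (2 * d).+1}|) *: sqmon n R d + S'.
Proof.
move=> PD QD Ssos PE P1 Q1 QP.
have t0 (v : 'rV[R]_n) f : meval (fun i => v 0 i) f = (translate v f)@_mnm0.
  by rewrite mcoeff0_meval meval_translate add0r.
have tD v f : f \is deg_le (2 * d) ->
    translate v f - (meval (fun i => v 0 i) f)%:MP \is deg_le (2 * d).
  by move=> fD; rewrite rpredB ?deg_le_translate ?deg_leC.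
pose e := (translate w Q - (meval (fun i => w 0 i) Q)%:MP) -
          (translate zb P - (meval (fun i => zb 0 i) P)%:MP).
have eta0 : 0 <= eta by exact: le_trans (QP mnm0).
have e0 : e@_mnm0 = 0.
  by rewrite !mcoeffB !mcoeffC eqxx !mulr1 -!t0 !subrr.
exists ((eta *+ #|{: bmultinom n (2 * d).+1}|) *: sqmon n R d + e + S).
  apply: sosD => //; apply: sos_perturbation; first by rewrite rpredB ?tD.
    move=> m; case mE : (mdeg m) => [|[|k]] // _.
      by move/eqP: mE; rewrite mdeg_eq0 => /eqP->.
    move/eqP: mE => /mdeg1P[i /eqP->].
    rewrite /e !mcoeffB !mcoeffC P1 Q1 mnm1_eq0.
    by rewrite !mulr0 !subrr.
  move=> m; have [->|m0] := eqVneq m mnm0; first by rewrite e0 normr0.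
  by rewrite /e !mcoeffB !mcoeffC (negbTE m0) !mulr0 !subr0.
rewrite -[LHS](subrK (translate zb P - (meval (fun i => zb 0 i) P)%:MP)) -/e.
rewrite PE scalerBl.
have absorb (x a b s : mpoly n R) : x + (a + s) = a - b + (b + x + s) by ring.
exact: absorb.
Qed.

(** Relative interiority is used in the single direction of [sqmon]: moving
    away from it stays in the span of the face, hence in the face. *)
Lemma relint_sos_face zb (q : polyle n R (2 * d)) :
  relint (sos_face zb) q ->
  exists2 eps : R, 0 < eps & exists2 S, sos d S &
    translate zb q = eps *: sqmon n R d + S.
Proof.
move=> [[q_sos q0] qnear].
have sqD : translate (- zb) (sqmon n R d) \is deg_le (2 * d).
  exact/deg_le_translate/deg_le_sos/sos_sqmon.
pose F := PolyLe sqD.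
have Fface : sos_face zb F.
  split; first exact/sos_translate/sos_sqmon.
  by rewrite /peval /= meval_translate subrr meval_sqmon0.
have face0 : sos_face zb (0 : polyle n R (2 * d)).
  by split; [exact: sos0 | exact: linear0].
have coefsE (t : R) : coefs (q - t *: F) = coefs q - t *: coefs F.
  by apply/rowP => i; rewrite !mxE /= mcoeffB mcoeffZ.
have cvgq : q - t *: F @[t --> (0 : R)] --> q.
  move=> A; rewrite nbhsE => -[_ [[V Vopen <-] Vq] VA].
  have cvgV : coefs q - t *: coefs F @[t --> (0 : R)] --> coefs q.
    have : coefs q - t *: coefs F @[t --> (0 : R)] --> coefs q - 0 *: coefs F.
      by apply: cvgB; [exact: cvg_cst | apply: cvgZr_tmp; exact: cvg_id].
    by rewrite scale0r subr0.
  have /cvgV : nbhs (coefs q) V by exact: open_nbhs_nbhs.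
  rewrite !nbhs_simpl /=; apply: filterS => t Vt.
  by apply: VA; rewrite /= coefsE.
(* q - t F = 1 q + (- t) F + t 0 is an affine combination of points of the
   face. *)
have /nbhs_norm0P[e /= e0 eq] :
    \forall t \near (0 : R), sos_face zb (q - t *: F).
  have := cvgq _ qnear; rewrite !nbhs_simpl /=; apply: filterS => t; apply.
  pose tt (i : 'I_3) := nth 0 [:: 1; - t; t] i.
  pose aa (i : 'I_3) : polyle n R (2 * d) := nth 0 [:: q; F; 0] i.
  exists 3%N, tt, aa; split.
  - by case=> [[|[|[|//]]]] /= i; rewrite /aa.
  - by rewrite !big_ord_recl big_ord0 /tt /= addr0 addNr addr0.
  - by rewrite !big_ord_recl big_ord0 /tt /aa /= scale1r scaler0 !addr0 scaleNr.
have e2 : `|e / 2| < e.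
  by rewrite gtr0_norm ?divr_gt0 // ltr_pdivrMr // ltr_pMr // ltr1n.
have [/= q_sos' _] := eq _ e2.
exists (e / 2); first by rewrite divr_gt0.
exists (translate zb (q - (e / 2) *: F)); first exact: sos_translate.
have FK := translateK (- zb) (sqmon n R d); rewrite opprK in FK.
rewrite /= (raddfB (translate zb)) /= [translate zb (_ *: _)]comp_mpolyZ.
by rewrite -/(translate zb _) FK addrCA subrr addr0.
Qed.

End Perturbation.

(** Polynomials of degree 0 are minimized everywhere. *)
Lemma unique_minimizer_degree_gt0 (R : realType) (n d : nat)
    (p : polyle n R (2 * d)) (z : 'rV[R]_n) :
  unique_minimizer p z -> (0 < n)%N -> (0 < d)%N.
Proof.
move=> [pz puniq] n_gt0; rewrite lt0n; apply/eqP => d0; subst d.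
have pE : (p : mpoly n R) = ((p : mpoly n R)@_mnm0)%:MP.
  exact: msize1_polyC (polyle_valP p).
have : z + const_mx 1 = z.
  by apply: puniq => z'; rewrite /peval pE !mevalC.
move/rowP/(_ (Ordinal n_gt0)); rewrite !mxE => /eqP.
by rewrite -subr_eq0 addrAC subrr add0r oner_eq0.
Qed.

Theorem theorem6p2 (R : realType) (k n d : nat) (Theta : set 'rV[R]_k)
    (p : 'rV[R]_k -> polyle n R (2 * d))
    (p_cont : {within Theta, continuous p})
    (thetab : 'rV[R]_k) (thetabT : Theta thetab)
    (gammab : R) (popE : val_POP (p thetab) = gammab%:E)
    (sosE : val_SOS (p thetab) = gammab%:E)
    (zb : 'rV[R]_n) (zb_min : unique_minimizer (p thetab) zb)
    (p_relint : relint (sos_face zb) (p thetab - pconst n (2 * d) gammab)) :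
  \forall theta \near within Theta (nbhs thetab),
    sos_tight (p theta) /\
    exists z : 'rV[R]_n,
      unique_minimizer (p theta) z /\ sos_recovers (p theta) z.
Proof.
have d_gt0 := unique_minimizer_degree_gt0 zb_min.
have [eps eps0 [S Ssos qE]] := relint_sos_face p_relint.
pose P : mpoly n R := p thetab.
have PD : P \is deg_le (2 * d) := polyle_valP (p thetab).
have PE : translate zb P - (meval (fun i => zb 0 i) P)%:MP =
    eps *: sqmon n R d + S.
  rewrite -qE raddfB /= translateC; congr (_ - _%:MP).
  have [[_]] := p_relint; rewrite /peval /= mevalB mevalC => /eqP.
  by rewrite subr_eq0 => /eqP.
have P_crit i : (translate zb P)@_(mnm1 i) = 0.
  apply: mcoeff_translate_min; apply/nbhs_rV_ltP; exists 1 => // z _.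
  exact: zb_min.1.
(* Absorbing a perturbation of size eta costs eta for each of the N
   monomials; this choice spends half of eps. *)
pose N := #|{: bmultinom n (2 * d).+1}|.
have N0 : (0 < N)%N by apply/card_gt0P; exists bm0.
pose eta := eps / 2 / N%:R.
have etaN : eta *+ N = eps / 2.
  by rewrite -mulr_natr divfK // pnatr_eq0 -lt0n.
have eta0 : 0 < eta by rewrite !divr_gt0 // ltr0n.
have thetabF : Filter (within Theta (nbhs thetab)) by exact: within_filter.
have p_cvg : p theta @[theta --> within Theta (nbhs thetab)] --> p thetab.
  by move/subspace_continuousP: p_cont; apply.
have [rho rho0 close_translate] := near_translate_le zb p_cvg eta0.
have [eta' eta'0 min_near] :=
  perturbed_local_minimizer d_gt0 PD eps0 rho0 Ssos PE.
have /(_ thetabF) close_coefs := near_mcoeff_le p_cvg eta'0.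
apply: filterS2 close_translate close_coefs => theta close_w close.
have fD := polyle_valP (p theta).
have [w w_near w_min] := min_near _ fD close.
have [S' S'sos fE] := perturbed_certificate PD fD Ssos PE P_crit
  (fun i => mcoeff_translate_min i w_min) (close_w w w_near).
by apply: certificate_tight_recovers d_gt0 _ S'sos fE; rewrite etaN; lra.
Qed.
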